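(* Let $n\in\mathbb N$ and let $\beta,\gamma$ be compositions of $n$. Then $$\sum_{\alpha}|\mathrm{CONS}(\alpha,\beta)|\,(-1)^{|S_\gamma\setminus S_\alpha|}=\begin{cases} n! & \text{if } \beta\le\gamma,\\ 0&\text{otherwise,}\end{cases}$$ where the sum ranges over all compositions $\alpha$ of $n$ such that $\alpha\le\beta$ and $S_\gamma$ is $\alpha$-unimodal.
   Context: A composition $\alpha=(\alpha_1,\dots,\alpha_\ell)$ of $n$ is a sequence of positive integers summing to $n$; $\ell(\alpha)=\ell$. Set $S_\alpha=\{\alpha_1,\alpha_1+\alpha_2,\dots,\alpha_1+\dots+\alpha_{\ell-1}\}\subseteq[n-1]$. Blocks: $B_i(\alpha)=\{\alpha_1+\dots+\alpha_{i-1}+1,\dots,\alpha_1+\dots+\alpha_i\}$. For compositions $\alpha,\beta$ of $n$, $\alpha\le\beta$ means $S_\beta\subseteq S_\alpha$ (i.e. $\beta$ is obtained by adding contiguous parts of $\alpha$). A set $S\subseteq[n-1]$ is $\alpha$-unimodal if for every $i$ the set $S\cap(B_i(\alpha)\setminus S_\alpha)$ is an initial segment (in increasing order) of $B_i(\alpha)\setminus S_\alpha$. For $\alpha\le\beta$ and $\sigma\in\mathfrak S_n$ (one-line notation), let $\sigma^{(i)}=\sigma_a\cdots\sigma_b$ where $B_i(\alpha)=[a,b]$. The permutation $\sigma$ is consistent with $\alpha\le\beta$ if (i) for each $i\in[\ell(\alpha)]$ the maximum of $\sigma^{(i)}$ is its last letter, and (ii) for each $k\in[\ell(\beta)]$,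 if $B_k(\beta)=\bigcup_{r=i}^jB_r(\alpha)$, then the maxima of $\sigma^{(i)},\dots,\sigma^{(j)}$ are increasing. $\mathrm{CONS}(\alpha,\beta)$ is the set of such permutations. *)

(* Defs.v *)
From HB Require Import structures.
From mathcomp Require Import all_boot all_order all_algebra all_fingroup.
Set Implicit Arguments. Unset Strict Implicit. Unset Printing Implicit Defensive.

Definition is_comp (n : nat) (a : seq nat) : bool :=
  all (fun x => 0 < x) a && (sumn a == n).

Fixpoint words (n l : nat) : seq (seq nat) :=
  match l with
  | 0 => [:: [::]]
  | l'.+1 => flatten [seq [seq x :: w | w <- words n l'] | x <- iota 1 n]
  end.

(* The (duplicate-free) list of all compositions of n. *)
Definition comps (n : nat) : seq (seq nat) :=
  [seq a <- flatten [seq words n l | l <- iota 0 n.+1] | is_comp n a].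

Definition Sset (a : seq nat) : seq nat :=
  [seq sumn (take i a) | i <- iota 1 (size a).-1].

(* Block B_i(alpha), i in 1..l(alpha) (1-based positions). *)
Definition block (a : seq nat) (i : nat) : seq nat :=
  iota (sumn (take i.-1 a)).+1 (nth 0 a i.-1).

Definition comp_le (a b : seq nat) : bool := all (fun x => x \in Sset a) (Sset b).

Definition unimodal (a : seq nat) (S : seq nat) : bool :=
  all (fun i =>
         let L := [seq x <- block a i | x \notin Sset a] in
         has (fun k => [seq x <- L | x \in S] == take k L) (iota 0 (size L).+1))
      (iota 1 (size a)).

(* one-line notation of s: sigma_p = nth 0 (oneline s) p.-1, values in 0..n-1 *)
Definition oneline (n : nat) (s : 'S_n) : seq nat := [seq val (s j) | j <- enum 'I_n].

Definition subword (n : nat) (s : 'S_n) (a : seq nat) (i : nat) : seq nat :=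
  [seq nth 0 (oneline s) p.-1 | p <- block a i].

Definition maxseq (w : seq nat) : nat := \max_(x <- w) x.

Definition consistent (n : nat) (a b : seq nat) (s : 'S_n) : bool :=
  all (fun i => last 0 (subword s a i) == maxseq (subword s a i)) (iota 1 (size a)) &&
  all (fun k =>
         let idxs := [seq r <- iota 1 (size a) |
                       all (fun p => p \in block b k) (block a r)] in
         sorted ltn [seq maxseq (subword s a r) | r <- idxs])
      (iota 1 (size b)).

Definition CONS (n : nat) (a b : seq nat) : {set 'S_n} :=
  [set s : 'S_n | consistent a b s].

(* Main.v *)
(** A permutation is consistent with alpha <= beta exactly when each end p of a
    block of alpha is a record of the word read from the start of the block of
    beta containing p. If that start is c(p) + 1, such a record has probability
    1 / (p - c(p)), and the records at different p are independent, so
    |CONS(alpha, beta)| = n! / prod_p (p - c(p)). The signed sum over alpha thus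
    becomes a sum over chains 0 < p_1 < ... < n of products of weights f(j, p)
    attached to the blocks (j, p]. Its partial sums U_p (over chains ending at p)
    satisfy U_p = sum_(j < p) U_j f(j, p), which is solved by U_p = 1 if no z < p
    lies in S_gamma but not in S_beta, and U_p = 0 otherwise: once the first such
    z is passed, the chains whose last cut before p is z - 1 cancel those whose
    last cut is z. *)
Require Import Defs.
From HB Require Import structures.
From mathcomp Require Import all_boot all_order all_algebra all_fingroup.
From mathcomp Require Import zify.
Import GRing.Theory Num.Theory.

(** * Enumeration of compositions by their first part *)

Lemma mem_words (n l : nat) (a : seq nat) :
  (a \in words n l) = (size a == l) && all (fun x => 0 < x <= n) a.
Proof.
elim: l a => [|l IH] [|x a] //=.
  by apply/negP => /flatten_mapP[y _ /mapP[]].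
rewrite eqSS; apply/flatten_mapP/idP => [[y]|/and3P[sa xn an]].
  rewrite mem_iota => yn /mapP[w]; rewrite IH => /andP[sw aw] [-> ->].
  by rewrite sw aw; lia.
by exists x; [rewrite mem_iota; lia | rewrite map_f // IH sa].
Qed.

(** The map [k] recovers from an element the index of the list it came from, so lists with different
    indices are disjoint. The uses take [head 0] or [size] for [k]. *)
Lemma uniq_flatten_map (T : eqType) (S : eqType) (h : T -> seq S) (k : S -> T)
    (s : seq T) :
  uniq s -> (forall x, x \in s -> uniq (h x)) ->
  (forall x y, y \in h x -> k y = x) -> uniq (flatten [seq h x | x <- s]).
Proof.
move=> + + hk; elim: s => //= x s IH /andP[xs us] hu.
rewrite cat_uniq hu ?mem_head // IH // ?andbT; last first.
  by move=> y ys; apply: hu; rewrite inE ys orbT.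
apply/hasPn => y /flatten_mapP[z zs yz]; apply: contra xs => /hk <-.
by rewrite (hk _ _ yz).
Qed.

Lemma words_uniq (n l : nat) : uniq (words n l).
Proof.
elim: l => //= l IH.
apply: (@uniq_flatten_map _ _ _ (head 0)) => [|x _|x y /mapP[w _ ->]] //.
  exact: iota_uniq.
by rewrite map_inj_uniq // => u v [].
Qed.

Lemma comps_uniq (n : nat) : uniq (comps n).
Proof.
apply: filter_uniq; apply: (@uniq_flatten_map _ _ _ size) => [|l _|l a].
- exact: iota_uniq.
- exact: words_uniq.
- by rewrite mem_words => /andP[/eqP].
Qed.

Lemma leq_size_sumn (a : seq nat) :
  all (fun x => 0 < x) a -> size a <= sumn a.
Proof. by elim: a => //= x a IH /andP[x0 /IH]; lia. Qed.

Lemma leq_all_sumn (a : seq nat) : all (fun x => x <= sumn a) a.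
Proof.
elim: a => //= x a IH; rewrite leq_addr /=.
by apply: sub_all IH => y /leq_trans; apply; apply: leq_addl.
Qed.

Lemma mem_comps (n : nat) (a : seq nat) : (a \in comps n) = is_comp n a.
Proof.
rewrite mem_filter; case: (boolP (is_comp n a)) => // /andP[a0 /eqP an].
rewrite andTb; apply/flatten_mapP; exists (size a).
  by rewrite mem_iota /= add0n ltnS -an leq_size_sumn.
rewrite mem_words eqxx /= -an.
by have := leq_all_sumn a; move/(conj a0)/andP; rewrite -all_predI.
Qed.

Lemma big_comps (R : zmodType) (n : nat) (G : seq nat -> R) :
  (\sum_(a <- comps n) G a =
   if n == 0 then G [::]
   else \sum_(1 <= x < n.+1) \sum_(a <- comps (n - x)) G (x :: a))%R.
Proof.
case: eqP => [->|/eqP n0].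
  have -> : comps 0 = [:: [::]] by [].
  by rewrite big_seq1.
rewrite -(big_allpairs_dep (h := cons)) /index_iota subn1 /=.
apply/perm_big/uniq_perm; first exact: comps_uniq.
  apply: (@uniq_flatten_map _ _ _ (head 0)) => [|x _|x y /mapP[w _ ->]] //.
    exact: iota_uniq.
  by rewrite map_inj_uniq ?comps_uniq // => u v [].
move=> [|x a]; rewrite mem_comps.
  rewrite /is_comp /= eq_sym (negbTE n0); apply/esym/negP.
  by move=> /allpairsPdep[x [a []]].
apply/idP/allpairsPdep => [/andP[/= /andP[x0 a0] /eqP xan]|[y [w []]]].
  exists x, a; rewrite mem_iota mem_comps /is_comp a0; split=> //; lia.
rewrite mem_iota mem_comps /is_comp => yn /andP[w0 /eqP wn] [-> ->] /=.
by rewrite w0; lia.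
Qed.

(** * Weighted sums over chains of cuts *)

Section Transfer.
Variables (R : comPzRingType) (f : nat -> nat -> R).
Local Open Scope ring_scope.

(** The offset [off] is the position where [a] starts; splitting off the first part [x] leaves a
    tail that starts at [off + x]. *)
Definition blockprod (off : nat) (a : seq nat) : R :=
  \prod_(i < size a)
     f (off + sumn (take i a)) (off + sumn (take i.+1 a)).

Lemma blockprod_cons (off x : nat) (a : seq nat) :
  blockprod off (x :: a) = f off (off + x) * blockprod (off + x) a.
Proof.
rewrite /blockprod big_ord_recl /= take0 /= !addn0; congr (_ * _).
by apply: eq_bigr => i _; rewrite !addnA.
Qed.

Variables (n : nat) (U : nat -> R).
Hypothesis U0 : U 0 = 1.
Hypothesis US : forall p, (0 < p <= n)%N -> \sum_(0 <= j < p) U j * f j p = U p.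

Let V j := \sum_(a <- comps (n - j)) blockprod j a.

Let Vrec j : (j < n)%N -> V j = \sum_(j.+1 <= p < n.+1) f j p * V p.
Proof.
move=> jn; rewrite /V big_comps subn_eq0 leqNgt jn /= -[in RHS](add1n j).
rewrite big_addn subSn 1?ltnW //; apply: eq_bigr => x _.
rewrite big_distrr subnDA subnAC; rewrite addnC; apply: eq_bigr => a _.
by rewrite blockprod_cons.
Qed.

(* U is row 0 and V is column n of the inverse of 1 - f, so U n and V 0 are the
   same entry; pairing the two recursions proves it without inverting. *)
Lemma sum_blockprod : \sum_(a <- comps n) blockprod 0 a = U n.
Proof.
have Vn : V n = 1.
  by rewrite /V subnn big_comps /= /blockprod big_ord0.
have E1 : \sum_(0 <= j < n) U j * V j = \sum_(1 <= p < n.+1) U p * V p.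
  transitivity (\sum_(0 <= j < n) \sum_(1 <= p < n.+1 | (j < p)%N)
                   U j * f j p * V p).
    apply: eq_big_nat => j /andP[_ jn].
    rewrite Vrec // (big_nat_widenl _ 1) // big_distrr /=.
    by apply: eq_bigr => p _; rewrite mulrA.
  rewrite (exchange_big_dep_nat xpredT) //; apply: eq_big_nat => p /andP[p0 pn].
  rewrite -big_distrl /= -US ?p0 //; congr (_ * _).
  rewrite [RHS](big_nat_widen _ _ n) //.
(* Splitting off [j = n] on one side and [j = 0] on the other leaves equal sums by [E1], hence
   [U n * V n = U 0 * V 0]. *)
have : \sum_(0 <= j < n.+1) U j * V j = \sum_(0 <= j < n.+1) U j * V j by [].
rewrite {1}big_nat_recr //= E1 big_nat_recl // big_add1 /= addrC => /addIr.
by rewrite Vn mulr1 U0 mul1r /V subn0 => ->.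
Qed.
End Transfer.

(** * Start of the block that contains a position *)

(* For S = S_beta, the block of beta containing p starts at prevS S p + 1. *)
Fixpoint prevS (S : pred nat) (p : nat) : nat :=
  if p is q.+1 then (if S q then q else prevS S q) else 0.

Lemma prevS_lt (S : pred nat) (p : nat) : 0 < p -> prevS S p < p.
Proof.
by elim: p => //= -[|p] IH _; case: ifP => // _; apply/leqW/IH.
Qed.

Lemma prevS_mem (S : pred nat) (p : nat) : prevS S p != 0 -> S (prevS S p).
Proof. by elim: p => //= p IH; case: ifP. Qed.

Lemma leq_prevS (S : pred nat) (z p : nat) : S z -> z < p -> z <= prevS S p.
Proof.
move=> Sz; elim: p => //= p IH; rewrite ltnS leq_eqVlt => /orP[/eqP <-|zp].
  by rewrite Sz.
by case: ifP => _; [apply: ltnW | apply: IH].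
Qed.

(** The windows from [prevS S p] to [p] and from [prevS S q] to [q] are nested with a common start,
    or disjoint. The independence of records rests on this. *)
Lemma prevS_nested (S : pred nat) (p q : nat) :
  0 < p -> p < q -> prevS S q = prevS S p \/ p <= prevS S q.
Proof.
move=> p0 pq; case: (leqP p (prevS S q)) => [|qp]; [by right | left].
apply/eqP; rewrite eqn_leq; apply/andP; split.
  have [->//|z0] := eqVneq (prevS S q) 0.
  by apply: leq_prevS qp; apply: prevS_mem.
have [->//|z0] := eqVneq (prevS S p) 0.
apply: leq_prevS; first exact: prevS_mem.
by apply: ltn_trans pq; apply: prevS_lt.
Qed.

(** * Initial segments and interiors of blocks *)

Fixpoint initseg (T : pred nat) (L : seq nat) : bool :=
  if L is x :: L' then (if T x then initseg T L' else ~~ has T L') else true.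

Lemma initseg_hasN (T : pred nat) (L : seq nat) : ~~ has T L -> initseg T L.
Proof. by case: L => //= x L; rewrite negb_or => /andP[/negbTE ->]. Qed.

(** Needed for the last block of alpha, whose end [n] is not in S_alpha and never in S_gamma. *)
Lemma initseg_rcons (T : pred nat) (L : seq nat) (x : nat) :
  ~~ T x -> initseg T (rcons L x) = initseg T L.
Proof.
move=> /negbTE Tx; elim: L => /= [|y L ->]; rewrite ?Tx //.
by rewrite has_rcons Tx.
Qed.

Lemma has_initseg (T : pred nat) (L : seq nat) :
  has (fun k => filter T L == take k L) (iota 0 (size L).+1) = initseg T L.
Proof.
elim: L => // x L IH.
have -> : iota 0 (size (x :: L)).+1 = 0 :: map S (iota 0 (size L).+1).
  by rewrite -[map _ _]/(map (addn 1) _) -iotaDl.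
move: (iota 0 _) IH => ks IH /=; rewrite has_map.
case: ifP => Tx /=.
  by rewrite -IH; apply: eq_has => k; rewrite /= eqseq_cons eqxx.
(* A nonempty prefix would begin with [x], which [T] rejects, so only [k = 0] can match. *)
rewrite [has T L]has_filter negbK; apply/orb_idr => /hasP[k _ /eqP E].
have : x \in filter T L by rewrite E mem_head.
by rewrite mem_filter Tx.
Qed.

Definition interior (j p : nat) : seq nat := iota j.+1 (p - j.+1).

Lemma mem_interior (j p x : nat) : (x \in interior j p) = (j < x < p).
Proof. by rewrite mem_iota; lia. Qed.

Lemma interior_cons (j p : nat) :
  j.+1 < p -> interior j p = j.+1 :: interior j.+1 p.
Proof.
by move=> jp; rewrite /interior -[p - j.+1]prednK ?subn_gt0 // -subnS.
Qed.

(** * Block weights and the cancellation in their recursion *)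

Section Weights.
Variables (S T : pred nat).
Hypothesis T0 : ~~ T 0.
Local Open Scope ring_scope.

(* The contribution of a block (j, p] of alpha: the first test says that no
   element of S_beta lies strictly between j and p. *)
Definition weight (j p : nat) : rat :=
  if (prevS S p <= j)%N && initseg T (interior j p)
  then (-1) ^+ count T (interior j p) / (p - prevS S p)%:R else 0.

(** With [S] = S_beta and [T] = S_gamma this is the solution U of the chain recursion; its value at
    [n] is the indicator of beta <= gamma. *)
Definition nobad (j : nat) : rat :=
  (~~ has (fun z => T z && ~~ S z) (iota 0 j))%:R.

Lemma nobad_rec (p : nat) :
  (0 < p)%N -> \sum_(0 <= j < p) nobad j * weight j p = nobad p.
Proof.
move=> p0; set lo := prevS S p; have lop : (lo < p)%N := prevS_lt S p p0.
(* For [lo <= j < p] the weight is [h j] divided by [p - lo], a denominator that does not depend on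
   [j]. *)
pose h j : rat := if initseg T (interior j p)
                  then (-1) ^+ count T (interior j p) else 0.
suff E : \sum_(lo <= j < p) nobad j * h j = (p - lo)%:R * nobad p.
  rewrite (big_cat_nat _ (ltnW lop)) //= big_nat big1 ?add0r; last first.
    move=> j /= jlo; rewrite /weight -/lo leqNgt.
    by have -> : (j < lo)%N by []; rewrite mulr0.
  have w0 : (p - lo)%:R != 0 :> rat by rewrite pnatr_eq0; lia.
  apply: (mulfI w0); rewrite -E mulr_sumr; apply: eq_big_nat => j /andP[loj _].
  rewrite /weight -/lo loj /h /=; case: ifP => _; last by rewrite !mulr0.
  by rewrite mulrCA; congr (_ * _); rewrite mulrC divfK.
have nobad1 j : (forall z, (z < j)%N -> T z -> S z) -> nobad j = 1.
  move=> H; rewrite /nobad; case: hasP => // -[z].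
  by rewrite mem_iota /= => /H zj /andP[/zj ->].
have nobad0 j t : (t < j)%N -> T t -> ~~ S t -> nobad j = 0.
  move=> tj Tt St; rewrite /nobad; case: hasP => // -[].
  by exists t; rewrite ?mem_iota ?Tt.
have inS z : (lo < z < p)%N -> ~~ S z.
  case/andP=> loz zp; apply/negP => /leq_prevS-/(_ p zp).
  by rewrite leqNgt loz.
have [/hasP ex|nb] :=
    boolP (has (fun z => T z && ~~ S z) (iota 0 p)); last first.
  (* Without bad elements [T] lies in [S] below [p], so it misses every interior beyond [lo], and
     each of the [p - lo] terms is 1. *)
  have TS z : (z < p)%N -> T z -> S z.
    move=> zp Tz; apply: contraNT nb => nS; apply/hasP; exists z.
      by rewrite mem_iota.
    by rewrite Tz.
  rewrite nobad1 // mulr1 -sumr_const_nat; apply: eq_big_nat => j /andP[loj jp].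
  rewrite nobad1 ?mul1r; last by move=> z zj; apply: TS; apply: ltn_trans jp.
  have nT : ~~ has T (interior j p).
    apply/hasPn => z; rewrite mem_interior => /andP[jz zp].
    by apply: contra (inS z _) => [/(TS _ zp)//|]; rewrite zp (leq_ltn_trans loj).
  by rewrite /h initseg_hasN //; move: nT; rewrite has_count -leqNgt leqn0 => /eqP->.
have ex' : exists t, (t < p)%N && (T t && ~~ S t).
  by case: ex => t; rewrite mem_iota => /= tp Ht; exists t; rewrite tp.
case: (ex_minnP ex') => t /and3P[tp Tt St] tmin.
have below z : (z < t)%N -> T z -> S z.
  move=> zt Tz; have [//|Sz] := boolP (S z).
  by have := tmin z; rewrite Tz Sz (ltn_trans zt tp) leqNgt zt => /(_ isT).
rewrite (nobad0 p t) // mulr0.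
have above a : (t < a)%N -> \sum_(a <= j < p) nobad j * h j = 0.
  move=> ta; rewrite big_nat big1 // => j /andP[aj _].
  by rewrite (nobad0 j t) ?mul0r // (leq_trans ta).
have [/above //|lot] := ltnP t lo.
have {}lot : (lo < t)%N.
  (* The least bad [t] differs from [lo]: [lo] is either 0, which is not in [T], or an element of
     [S]. *)
  rewrite ltn_neqAle lot andbT; apply: contraNneq St => lot'; rewrite -lot'.
  by apply: prevS_mem; rewrite -/lo lot'; apply: contraNneq T0 => <-.
case: t lot tp Tt St {tmin} below above => // t lot tp Tt St below above.
rewrite (big_cat_nat _ (n := t)) //=; last by apply: ltnW; apply: ltnW.
(* The least bad element is now called [t.+1]. For a cut [j < t] the interior starts with [j.+1]
   outside [T] but contains [t.+1] in [T], so the initial segment test fails. *)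
rewrite [X in X + _]big_nat [X in X + _]big1 ?add0r => [|j /andP[loj jt]]; last first.
  rewrite /h interior_cons /=; last by apply: leq_ltn_trans tp; apply: leqW.
  have /negbTE -> : ~~ T j.+1.
    apply: contra (inS j.+1 _) => [/below->//|]; rewrite ltnS loj /=.
    by apply: leq_ltn_trans tp; apply: leqW.
  have -> : has T (interior j.+1 p) by apply/hasP; exists t.+1; rewrite // mem_interior tp andbT ltnS.
  by rewrite mulr0.
(* The two choices for the last cut before p, at t and at t + 1, cancel. *)
rewrite big_ltn 1?ltnW // big_ltn // above // addr0.
rewrite !nobad1 ?mul1r => [|z /below//|z zt]; last by apply: below; apply: ltnW.
rewrite /h (interior_cons _ _ tp) /= Tt; case: ifP => _; last by rewrite addr0.
by rewrite add1n exprS mulN1r addNr.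
Qed.
End Weights.

(** * Counting permutations with prescribed records *)

Section Records.
Variable (n : nat).
Implicit Types (s : 'S_n) (p q lo : nat).

Definition letter s p : nat := nth 0 (oneline s) p.-1.

Lemma letterS s (q : 'I_n) : letter s q.+1 = s q.
Proof.
by rewrite /letter /oneline /= (nth_map q) ?size_enum_ord ?nth_ord_enum.
Qed.

Lemma letter_inj s p q :
  0 < p <= n -> 0 < q <= n -> letter s p = letter s q -> p = q.
Proof.
case: p => // p pn; case: q => // q qn; rewrite /= in pn qn.
rewrite (letterS s (Ordinal pn)) (letterS s (Ordinal qn)).
by move=> /val_inj/perm_inj [->].
Qed.

(* Positions are counted from 1, so q : 'I_n stands for position q.+1. *)
Definition record lo p s : bool :=
  [forall q : 'I_n, (lo <= q < p) ==> (s q <= letter s p)].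

Lemma recordP lo p s : p <= n ->
  reflect (forall q, lo < q <= p -> letter s q <= letter s p) (record lo p s).
Proof.
move=> pn; apply: (iffP forallP) => H q.
  case: q => // q /andP[loq qp].
  have qn : q < n := leq_trans qp pn.
  have /implyP := H (Ordinal qn); rewrite -(letterS s (Ordinal qn)) /=.
  by apply; rewrite -ltnS loq.
by apply/implyP => /andP[loq qp]; rewrite -letterS H // ltnS loq.
Qed.

(** Exchanging two letters of the window before [p] does not change the set of letters that [p] has
    to dominate. *)
Lemma record_tperm lo p s (q e : 'I_n) :
  p <= n -> lo <= q < p.-1 -> lo <= e < p.-1 ->
  record lo p s -> record lo p (tperm q e * s)%g.
Proof.
case: p => [_ /andP[]//|p pn /andP[loq qp] /andP[loe ep] /forallP H].
apply/forallP => r; apply/implyP => /andP[lor rp].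
rewrite (letterS _ (Ordinal pn)) !permM.
have neq (x : 'I_n) : x < p -> x != Ordinal pn by move=> xp; rewrite -val_eqE /= ltn_eqF.
rewrite [tperm q e (Ordinal pn)]tpermD ?neq //.
have /implyP := H (tperm q e r); rewrite (letterS _ (Ordinal pn)) => -> //.
case: tpermP => [_|_|_ _]; rewrite ?loq ?loe ?lor //=; exact: ltnW.
Qed.

Lemma record_tperm_disjoint lo p s (q e : 'I_n) :
  lo < p <= n -> q < lo -> e < lo ->
  record lo p s -> record lo p (tperm q e * s)%g.
Proof.
case: p => // p /andP[lop pn] qlo elo /forallP H.
have neq (x r : 'I_n) : x < lo -> lo <= r -> x != r.
  by move=> xlo lor; rewrite -val_eqE /= ltn_eqF // (leq_trans xlo).
apply/forallP => r; apply/implyP => /andP[lor rp].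
rewrite (letterS _ (Ordinal pn)) !permM !tpermD ?neq //.
by have /implyP := H r; rewrite (letterS _ (Ordinal pn)) lor rp; apply.
Qed.

Variable S : pred nat.

Definition recordS s p : bool := record (prevS S p) p s.

(* Exchanging the position of the maximum of the block prevS S p + 1 .. p with
   p does not affect the records required at later positions. *)
Lemma card_records_cons p (l : seq nat) :
  0 < p <= n -> all (fun p' => p < p' <= n) l ->
  #|[set s : 'S_n | all (recordS s) (p :: l)]| * (p - prevS S p)
  = #|[set s : 'S_n | all (recordS s) l]|.
Proof.
case: p => // p pn ln; rewrite /= in pn.
set lo := prevS S p.+1; have lop : lo <= p by apply: (prevS_lt S p.+1).
pose e := Ordinal pn.
pose top (q : 'I_n) s := [forall r : 'I_n, (lo <= r <= p) ==> (s r <= s q)].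
have toph s : recordS s p.+1 = top e s.
  by apply: eq_forallb => r; rewrite -/lo ltnS (letterS s e).
have inv (q : 'I_n) s : lo <= q <= p -> all (recordS s) l ->
    all (recordS (tperm q e * s)%g) l.
  move=> /andP[loq qp] /allP H; apply/allP => p' p'l; have := H _ p'l.
  have /andP[pp' p'n] := allP ln _ p'l.
  (* The window of a later [p'] either contains both exchanged positions strictly before [p'], or
     starts after both. *)
  have [E|le] := prevS_nested S p.+1 p' isT pp'; rewrite /recordS.
    rewrite E; apply: record_tperm => //=; rewrite ?loq ?lop /=; lia.
  apply: record_tperm_disjoint; rewrite ?p'n ?andbT //=; try lia.
  by apply: prevS_lt; lia.
have inj (q : 'I_n) s : lo <= q <= p ->
    all (recordS (tperm q e * s)%g) l = all (recordS s) l.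
  move=> qlop; apply/idP/idP => [/(inv q _ qlop)|]; last exact: inv.
  by rewrite mulgA tperm2 mul1g.
have top_tperm (q : 'I_n) s : lo <= q <= p ->
    top q (tperm q e * s)%g = top e s.
  move=> /andP[loq qp].
  have tI (r : 'I_n) : lo <= r <= p -> lo <= tperm q e r <= p.
    by case: tpermP => [_ _|_ _|//]; rewrite ?loq ?lop /=.
  apply/forallP/forallP => H r; apply/implyP => /tI rI.
    by have /implyP/(_ rI) := H (tperm q e r); rewrite !permM tpermK tpermL.
  by rewrite !permM tpermL; have /implyP/(_ rI) := H (tperm q e r).
(* The maximum of the window is attained at exactly one position. *)
have top1 s : \sum_(q < n | lo <= q <= p) top q s = 1.
  have e_in : lo <= e <= p by rewrite lop /=.
  case: (@arg_maxnP _ e (fun q : 'I_n => lo <= q <= p)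
                    (fun q : 'I_n => s q : nat) e_in) => q qI qmax.
  rewrite (bigD1 q) //= big1 ?addn0 => [|r /andP[rI rq]].
    by rewrite /top; case: forallP => // -[r]; apply/implyP => /qmax.
  apply/eqP; rewrite eqb0; apply: contra rq => /forallP/(_ q)/implyP/(_ qI) qr.
  by rewrite -(inj_eq (@perm_inj _ s)) -val_eqE /= eqn_leq qr andbT; apply: qmax.
rewrite -!sum1dep_card /=.
(* Double counting: by the transpositions each of the [p.+1 - lo] positions [q] is the top equally
   often as [e], while summing over [q] first counts each [s] once. *)
transitivity (\sum_(q < n | lo <= q <= p)
                \sum_(s : 'S_n | all (recordS s) l) (top q s : nat)).
  rewrite [RHS](eq_bigr (fun _ => \sum_(s : 'S_n | all (recordS s) l)
                                (top e s : nat))); last first.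
    move=> q qI; rewrite (reindex_inj (mulgI (tperm q e))) /=.
    by apply: eq_big => s; rewrite ?inj // top_tperm.
  rewrite [RHS]sum_nat_const [RHS]mulnC; congr (_ * _).
    rewrite [RHS]big_mkcond [LHS]big_mkcond; apply: eq_bigr => s _.
    by rewrite toph; case: (top e s); case: (all _ _).
  rewrite -/lo; have -> : p.+1 - lo = \sum_(lo <= q < p.+1) 1.
    by rewrite sum_nat_const_nat muln1.
  rewrite (big_nat_widenl _ 0) // (big_nat_widen _ _ n) // big_mkord sum1_card.
  exact: eq_card.
rewrite exchange_big; apply: eq_bigr => s _; exact: top1.
Qed.

(** Independence of the records, stated without division. As the list increases, its head can be
    removed by [card_records_cons]; with no condition left all permutations count. *)
Lemma prod_card_records (l : seq nat) :
  sorted ltn l -> all (fun p => 0 < p <= n) l ->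
  #|[set s : 'S_n | all (recordS s) l]| * \prod_(p <- l) (p - prevS S p) = n`!.
Proof.
elim: l => [_ _|p l IH pl /andP[pn ln]].
  rewrite big_nil muln1 -[RHS](card_Sn n); apply: eq_card => s.
  by rewrite !inE.
rewrite big_cons mulnA card_records_cons // ?IH //; first exact: path_sorted pl.
move: pl; rewrite /= (path_sortedE ltn_trans) => /andP[pl _].
by apply/allP => q ql; rewrite (allP pl _ ql); case/andP: (allP ln _ ql).
Qed.
End Records.

(** * Blocks and cut sets through partial sums *)

Definition psum (a : seq nat) (i : nat) : nat := sumn (take i a).

Lemma psumS (a : seq nat) (i : nat) : psum a i.+1 = psum a i + nth 0 a i.
Proof.
rewrite /psum; have [ia|ai] := ltnP i (size a).
  by rewrite (take_nth 0) // sumn_rcons.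
by rewrite !take_oversize ?nth_default ?addn0 // ltnW.
Qed.

Lemma leq_psum (a : seq nat) : {homo psum a : i j / i <= j}.
Proof. by apply: homo_leq leq_trans _ => // i; rewrite psumS leq_addr. Qed.

Lemma psum_locate (a : seq nat) (x : nat) :
  0 < x <= sumn a -> exists2 i, i < size a & psum a i < x <= psum a i.+1.
Proof.
rewrite -[sumn a](congr1 sumn (take_size a)) -/(psum a _).
move: (size a) => m; elim: m => [|m IH] /andP[x0 xm].
  by move: xm; rewrite /psum take0 leqNgt x0.
case: (leqP x (psum a m)) => [xle|xgt]; last by exists m; rewrite ?xgt.
by have [|i im ix] := IH; rewrite ?x0 //; exists i; first exact: ltnW.
Qed.

Lemma SsetP (a : seq nat) (x : nat) :
  reflect (exists2 i, 0 < i < size a & x = psum a i) (x \in Sset a).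
Proof.
by apply: (iffP mapP) => -[i ia ->]; exists i => //; move: ia; rewrite mem_iota; lia.
Qed.

Lemma block_mem (a : seq nat) (i x : nat) :
  (x \in block a i.+1) = (psum a i < x <= psum a i.+1).
Proof. by rewrite mem_iota addSn ltnS -psumS. Qed.

Section Composition.
Variables (n : nat) (a : seq nat).
Hypothesis ha : is_comp n a.

Lemma psum_lt (i : nat) : i < size a -> psum a i < psum a i.+1.
Proof.
case/andP: ha => a0 _ ia; rewrite psumS -{1}[psum a i]addn0 ltn_add2l.
exact: (all_nthP 0 a0).
Qed.

Lemma psum_mono (i j : nat) : i < j <= size a -> psum a i < psum a j.
Proof.
move=> /andP[ij ja]; apply: leq_trans (leq_psum a _ _ ij).
by apply: psum_lt; apply: leq_trans ja.
Qed.

Lemma psum_size : psum a (size a) = n.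
Proof. by rewrite /psum take_size; case/andP: ha => _ /eqP. Qed.

Lemma psum_le (i : nat) : psum a i <= n.
Proof.
rewrite -psum_size; case: (leqP i (size a)) => [|ai]; first exact: leq_psum.
by rewrite /psum !take_oversize // ltnW.
Qed.

Lemma psum_in_Sset (i : nat) : 0 < psum a i < n -> psum a i \in Sset a.
Proof.
move=> range; apply/SsetP; exists i => //; case: i range => [|i].
  by rewrite /psum take0.
case: (ltnP i.+1 (size a)) => // ai; rewrite -psum_size /psum.
by rewrite !take_oversize // ltnn andbF.
Qed.

Lemma Sset_bounds (x : nat) : x \in Sset a -> 0 < x < n.
Proof.
case/SsetP => i /andP[i0 ia] ->; rewrite -psum_size psum_mono ?ia ?leqnn //.
by rewrite andbT -[0]/(sumn [::]) -(take0 a) psum_mono // i0 ltnW.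
Qed.

Lemma interior_notin_Sset (i x : nat) :
  psum a i < x < psum a i.+1 -> x \notin Sset a.
Proof.
move=> /andP[ix xi]; apply/SsetP => -[j _ E]; move: ix xi; rewrite {}E => ij ji.
case: (leqP j i) => [/(leq_psum a)|/(leq_psum a)]; first by rewrite leqNgt ij.
by rewrite leqNgt ji.
Qed.

Lemma Sset_uniq : uniq (Sset a).
Proof.
rewrite map_inj_in_uniq ?iota_uniq // => i j; rewrite !mem_iota => ia ja.
rewrite -/(psum a i) -/(psum a j) => E.
by case: (ltngtP i j) => // lt; [have := psum_mono i j | have := psum_mono j i];
  rewrite E ltnn lt /= => /(_ _)/negP[]; lia.
Qed.

Lemma block_rcons (i : nat) : i < size a ->
  block a i.+1 = rcons (interior (psum a i) (psum a i.+1)) (psum a i.+1).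
Proof.
move=> /psum_lt lt; rewrite /block /= -/(psum a i).
have -> : nth 0 a i = (psum a i.+1 - (psum a i).+1).+1.
  by move: lt; rewrite psumS; lia.
by rewrite -[X in iota _ X]addn1 iotaD cats1 addnC subnK.
Qed.

(** Splits the exponent of the sign over the blocks of alpha, so that the sign becomes a product of
    block contributions. *)
Lemma count_notin_Sset (T : seq nat) : uniq T -> (forall x, x \in T -> 0 < x < n) ->
  count (fun x => x \notin Sset a) T
  = \sum_(i < size a) count (mem T) (interior (psum a i) (psum a i.+1)).
Proof.
move=> uT Tn; pose Q x := (x \in T) && (x \notin Sset a).
have -> : count (fun x => x \notin Sset a) T = count Q (iota 0 n).
  have /seq.permP/(_ (fun x => x \notin Sset a)) -> :
      perm_eq T (filter (mem T) (iota 0 n)).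
    apply: uniq_perm; rewrite ?filter_uniq ?iota_uniq // => x.
    rewrite mem_filter mem_iota /=; apply/idP/andP => [xT|[]//].
    by split=> //; case/andP: (Tn _ xT).
  by rewrite count_filter; apply: eq_count => x; rewrite /Q /= andbC.
rewrite -psum_size.
suff H m : m <= size a -> count Q (iota 0 (psum a m))
    = \sum_(i < m) count (mem T) (interior (psum a i) (psum a i.+1)) by exact: H.
elim: m => [|m IH] ma; first by rewrite big_ord0 /psum take0.
rewrite big_ord_recr -IH 1?ltnW //= psumS iotaD count_cat; congr (_ + _).
have lt := psum_lt m ma; rewrite -psumS add0n.
have -> : nth 0 a m = (psum a m.+1 - (psum a m).+1).+1.
  by move: lt; rewrite psumS; lia.
rewrite /= -/(interior _ _).
(* The left end of a block is 0, which is not in [T], or a cut of [a]. *)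
have -> : Q (psum a m) = false.
  apply/negP => /andP[/Tn lt0 /negP]; apply; exact: psum_in_Sset.
apply: eq_in_count => x; rewrite mem_interior /Q => /interior_notin_Sset ->.
by rewrite andbT.
Qed.

(** Deleting S_alpha from a block leaves its interior, except that the last block keeps its end [n];
    as [n] is not in [T], the test is unaffected. *)
Lemma unimodalE (T : seq nat) : n \notin T ->
  unimodal a T
  = [forall i : 'I_(size a),
       initseg (mem T) (interior (psum a i) (psum a i.+1))].
Proof.
move=> nT; have E i : i < size a ->
  let L := [seq x <- block a i.+1 | x \notin Sset a] in
  has (fun k => [seq x <- L | x \in T] == take k L) (iota 0 (size L).+1)
  = initseg (mem T) (interior (psum a i) (psum a i.+1)).
  move=> ia L; rewrite (has_initseg (mem T)) {}/L block_rcons // filter_rcons.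
  have -> : [seq x <- interior (psum a i) (psum a i.+1) | x \notin Sset a]
            = interior (psum a i) (psum a i.+1).
    by apply/all_filterP/allP => x; rewrite mem_interior => /interior_notin_Sset.
  case: ifP => // /negP aS; apply: initseg_rcons => /=.
  suff -> : psum a i.+1 = n by [].
  have := psum_le i.+1; rewrite leq_eqVlt => /orP[/eqP//|lt]; case: aS; apply: psum_in_Sset.
  by rewrite lt andbT (leq_ltn_trans _ (psum_lt i ia)).
apply/allP/forallP => H.
  by move=> i; rewrite -E //; apply: H; rewrite mem_iota /= add1n ltnS.
move=> [|i]; rewrite mem_iota //= add1n ltnS => ia.
exact: (etrans (E i ia) (H (Ordinal ia))).
Qed.

End Composition.

(** * Refinement and consistency as conditions on block ends *)

Lemma pairwise_ltn_sortedP (r : rel nat) (s : seq nat) : sorted ltn s ->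
  reflect {in s &, forall x y, x < y -> r x y} (pairwise r s).
Proof.
elim: s => [_|x s IH xs]; first by apply: (iffP idP).
move: xs; rewrite /= (path_sortedE ltn_trans) => /andP[/allP xs /IH {}IH].
apply: (iffP andP) => [[/allP rx /IH rs] y z|H]; last first.
  split; last by apply/IH => y z ys zs; apply: H; rewrite inE ?ys ?zs orbT.
  by apply/allP => y ys; apply: H; rewrite ?mem_head ?inE ?ys ?orbT //; apply: xs.
rewrite !inE => /orP[/eqP ->|ys] /orP[/eqP ->|zs]; rewrite ?ltnn //.
- by move=> _; apply: rx.
- by have /= yx := xs _ ys; rewrite ltnNge ltnW.
- exact: rs.
Qed.

Lemma psum_prevS (n : nat) (b : seq nat) (p : nat) :
  is_comp n b -> 0 < p <= n ->
  exists2 k, k < size b &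
    psum b k = prevS (mem (Sset b)) p /\ p <= psum b k.+1.
Proof.
move=> hb pn; have /andP[_ /eqP bn] := hb; rewrite -bn in pn.
have [k kb /andP[kp pk]] := psum_locate b p pn; exists k => //; split=> //.
apply/eqP; rewrite eqn_leq; apply/andP; split.
  have [->//|k0] := eqVneq (psum b k) 0; apply: leq_prevS => //=.
  apply: (psum_in_Sset n b hb); rewrite lt0n k0 (leq_trans kp) //.
  by rewrite (leq_trans pk) // (psum_le n b hb).
rewrite leqNgt; apply/negP => lt.
have := @prevS_mem (mem (Sset b)) p; rewrite -lt0n (leq_ltn_trans _ lt) //.
move/(_ isT); apply/negP; apply: (interior_notin_Sset b k).
by rewrite lt (leq_trans _ pk) // prevS_lt //; case/andP: pn.
Qed.

(** Refinement means that no cut of beta falls strictly inside a block of alpha, which [prevS]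
    detects at the end of each block. *)
Lemma comp_leE (n : nat) (a b : seq nat) : is_comp n a -> is_comp n b ->
  comp_le a b
  = [forall i : 'I_(size a), prevS (mem (Sset b)) (psum a i.+1) <= psum a i].
Proof.
move=> ha hb; apply/allP/forallP => [H i|H x xb].
  rewrite leqNgt; apply/negP => lt.
  have := @prevS_mem (mem (Sset b)) (psum a i.+1).
  rewrite -lt0n (leq_ltn_trans _ lt) // => /(_ isT)/H.
  apply/negP; apply: (interior_notin_Sset a i); rewrite lt prevS_lt //.
  exact: leq_ltn_trans (psum_lt n a ha i _).
have /andP[x0 xn] := Sset_bounds n b hb x xb.
have /andP[_ /eqP an] := ha; have := psum_locate a x; rewrite an x0 ltnW //.
case=> // i ia /andP[ix]; rewrite leq_eqVlt => /orP[/eqP xi|xi].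
  by rewrite xi; apply: (psum_in_Sset n a ha); rewrite -xi x0.
have := H (Ordinal ia); rewrite leqNgt (leq_trans ix) //.
exact: leq_prevS.
Qed.

Section Consistent.
Variables (n : nat) (a b : seq nat).
Hypotheses (ha : is_comp n a) (hb : is_comp n b).
Variable (s : 'S_n).

Let last_subword i : i < size a ->
  last 0 (subword s a i.+1) = letter n s (psum a i.+1).
Proof. by move=> ia; rewrite /subword (block_rcons n) // map_rcons last_rcons. Qed.

Let maxseq_block i : i < size a ->
  (last 0 (subword s a i.+1) == maxseq (subword s a i.+1))
  = record n (psum a i) (psum a i.+1) s.
Proof.
move=> ia; rewrite last_subword // /maxseq /subword big_map eqn_leq.
have -> /= : letter n s (psum a i.+1)
    <= \max_(q <- block a i.+1) nth 0 (oneline s) q.-1.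
  apply: (leq_bigmax_seq (F := fun q => letter n s q)) => //.
  by rewrite block_mem leqnn (psum_lt n).
apply/bigmax_leqP_seq/recordP => [|H q qi|H q + _].
- exact: psum_le.
- by apply: H => //; rewrite block_mem.
- by rewrite block_mem; apply: H.
Qed.

(** By (i) the end of a block of alpha dominates its own block, and by (ii) it dominates the earlier
    ends in the same block of beta; together this is a record over the whole window. *)
Lemma consistentE : comp_le a b ->
  consistent a b s
  = all (recordS n (mem (Sset b)) s) [seq psum a i.+1 | i <- iota 0 (size a)].
Proof.
rewrite (comp_leE n) // => /forallP le_ab.
have {}le_ab i : i < size a -> prevS (mem (Sset b)) (psum a i.+1) <= psum a i.
  by move=> ia; apply: (le_ab (Ordinal ia)).
have pos i : i < size a -> 0 < psum a i.+1 <= n.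
  move=> ia; rewrite (psum_le n) // andbT.
  exact: leq_ltn_trans (psum_lt n a ha i ia).
pose idxs k := [seq r <- iota 1 (size a) |
                  all (fun p => p \in block b k) (block a r)].
have idxs_sorted k : sorted ltn (idxs k).
  by apply: sorted_filter; [apply: ltn_trans | apply: iota_ltn_sorted].
have mem_idxs k r : (r.+1 \in idxs k.+1) =
    [&& r < size a, psum b k <= psum a r & psum a r.+1 <= psum b k.+1].
  rewrite mem_filter mem_iota /= add1n ltnS andbC; case: ltnP => //= ra.
  apply/allP/andP => [H|[bk kb] x].
    have lt := psum_lt n a ha r ra.
    have : psum b k < psum a r.+1 <= psum b k.+1.
      by rewrite -block_mem H // block_mem lt leqnn.
    have : psum b k < (psum a r).+1 <= psum b k.+1.
      by rewrite -block_mem H // block_mem leqnn lt.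
    by rewrite ltnS => /andP[-> _] /andP[_ ->].
  rewrite !block_mem => /andP[rx xr].
  by rewrite (leq_ltn_trans bk) // (leq_trans xr).
have E : consistent a b s =
    all (fun i => record n (psum a i) (psum a i.+1) s) (iota 0 (size a)) &&
    all (fun k => sorted ltn [seq maxseq (subword s a r) | r <- idxs k.+1])
      (iota 0 (size b)).
  have all_iota1 P m : all P (iota 1 m) = all (fun i => P i.+1) (iota 0 m).
    by rewrite (iotaDl 1 0) all_map.
  rewrite /consistent !all_iota1; congr (_ && _).
  apply: eq_in_all => i; rewrite mem_iota => /andP[_ ia].
  exact: maxseq_block.
rewrite {}E all_map; apply/andP/allP => [[/allP H1 /allP H2] i|H].
  rewrite mem_iota add0n => /= ia.
  have {}H1 j : j < size a -> record n (psum a j) (psum a j.+1) s.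
    by move=> ja; apply: H1; rewrite mem_iota.
  apply/recordP; first exact: psum_le.
  move=> q /andP[cq qi].
  have [k kb [kc ik]] := psum_prevS n b _ hb (pos i ia).
  have := psum_locate a q; case/andP: (ha) => _ /eqP ->.
  rewrite (leq_ltn_trans _ cq) // (leq_trans qi) ?(psum_le n) //.
  case=> // j ja /andP[jq qj].
  have jqj : letter n s q <= letter n s (psum a j.+1).
    by have /recordP := H1 _ ja; apply; rewrite ?(psum_le n) // jq.
  apply: leq_trans jqj _; have [ij|ji] := leqP i j.
    move: ij; rewrite leq_eqVlt => /orP[/eqP -> //|/(leq_psum a) ij].
    by have := leq_ltn_trans ij jq; rewrite ltnNge qi.
  have jk : j.+1 \in idxs k.+1.
    rewrite mem_idxs ja kc /= (leq_trans _ ik) ?andbT; last first.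
      by apply: leq_psum; apply: ltnW.
    (* The block of alpha around [q] ends beyond [psum b k], and [le_ab] forbids it to straddle that
       cut. *)
    apply: leq_trans (le_ab _ ja); rewrite -kc in cq *.
    have [->//|k0] := eqVneq (psum b k) 0.
    apply: leq_prevS; last exact: leq_trans qj.
    apply: (psum_in_Sset n b hb); rewrite lt0n k0 (leq_trans cq) //.
    by rewrite (leq_trans qi) // (psum_le n).
  have ik' : i.+1 \in idxs k.+1 by rewrite mem_idxs ia kc ik le_ab.
  have := H2 k; rewrite mem_iota (sorted_pairwise ltn_trans) pairwise_map.
  move=> /(_ kb)/(pairwise_ltn_sortedP _ _ (idxs_sorted _)).
  move=> /(_ _ _ jk ik'); rewrite ltnS => /(_ ji) /=.
  rewrite -(eqP (etrans (maxseq_block _ ja) (H1 _ ja))).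
  rewrite -(eqP (etrans (maxseq_block _ ia) (H1 _ ia))).
  by rewrite !last_subword // => /ltnW.
have {}H i : i < size a -> recordS n (mem (Sset b)) s (psum a i.+1).
  by move=> ia; apply: H; rewrite mem_iota.
have H1 i : i < size a -> record n (psum a i) (psum a i.+1) s.
  move=> ia; have /recordP H' := H _ ia; apply/recordP; first exact: psum_le.
  move=> q /andP[iq qi]; apply: H'; rewrite ?(psum_le n) // qi andbT.
  exact: leq_ltn_trans (le_ab _ ia) iq.
split; apply/allP => k; rewrite mem_iota => /andP[_ kb]; first exact: H1.
rewrite (sorted_pairwise ltn_trans) pairwise_map.
have idx0 : (0 \in idxs k.+1) = false by rewrite mem_filter mem_iota andbF.
apply/(pairwise_ltn_sortedP _ _ (idxs_sorted _)) => -[|j] [|i]; rewrite ?idx0 //.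
rewrite !mem_idxs ltnS.
move=> /and3P[ja kj jk] /and3P[ia ki ik] ji /=.
rewrite -(eqP (etrans (maxseq_block _ ja) (H1 _ ja))).
rewrite -(eqP (etrans (maxseq_block _ ia) (H1 _ ia))).
rewrite !last_subword // ltn_neqAle.
have lt : psum a j.+1 < psum a i.+1 by apply: (psum_mono n) => //; rewrite ltnS ji.
apply/andP; split.
  apply/negP => /eqP/letter_inj E; move: lt; rewrite E ?ltnn //; exact: pos.
have /recordP := H _ ia; apply; rewrite ?(psum_le n) // (ltnW lt) andbT.
(* Otherwise a cut of beta at or after the end of the earlier block would lie strictly inside the
   block of beta containing both. *)
rewrite ltnNge; apply/negP => ge.
have := @prevS_mem (mem (Sset b)) (psum a i.+1).
have jpos : 0 < psum a j.+1 by case/andP: (pos _ ja).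
rewrite -lt0n (leq_trans jpos) // => /(_ isT).
apply/negP; apply: (interior_notin_Sset b k); apply/andP; split.
  by apply: leq_trans ge; apply: leq_ltn_trans kj (psum_lt _ _ ha _ ja).
by apply: leq_trans ik; apply: prevS_lt; case/andP: (pos _ ia).
Qed.
End Consistent.

(** * Each summand as a product of block weights *)

Section MainTerm.
Variables (n : nat) (b g : seq nat).
Hypotheses (hb : is_comp n b) (hg : is_comp n g).

Lemma card_CONS (a : seq nat) : is_comp n a -> comp_le a b ->
  #|CONS n a b| * \prod_(i < size a) (psum a i.+1 - prevS (mem (Sset b)) (psum a i.+1))
  = n`!.
Proof.
move=> ha ab.
rewrite -(prod_card_records n (mem (Sset b)) [seq psum a i.+1 | i <- iota 0 (size a)]).
- rewrite big_map -[iota _ _](congr1 (iota 0) (subn0 _)) -/(index_iota _ _) big_mkord.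
  congr (_ * _); apply: eq_card => s; rewrite !inE /index_iota subn0; exact: consistentE.
- rewrite sorted_map.
  apply: (sub_in_sorted (P := gtn (size a)) _ _ (iota_ltn_sorted 0 (size a))).
    by move=> i j _ /= ja ij; apply: (psum_mono n) => //; rewrite ltnS ij.
  by apply/allP => i; rewrite mem_iota.
apply/allP => _ /mapP[i + ->]; rewrite mem_iota => /andP[_ ia].
rewrite (psum_le n) // andbT; exact: leq_ltn_trans (psum_lt n a ha i ia).
Qed.

(** The range condition of the sum is absorbed into the product: it fails exactly when some block
    fails its test and so has weight 0. *)
Lemma term_blockprod (a : seq nat) : is_comp n a ->
  (((if comp_le a b && unimodal a (Sset g) then
     Posz #|CONS n a b| * (-1) ^+ count (fun x => x \notin Sset a) (Sset g)
   else 0)%:~R : rat)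
  = n`!%:R * blockprod rat (weight (mem (Sset b)) (mem (Sset g))) 0 a)%R.
Proof.
move=> ha.
pose A (i : nat) := prevS (mem (Sset b)) (psum a i.+1) <= psum a i.
pose B (i : nat) := initseg (mem (Sset g)) (interior (psum a i) (psum a i.+1)).
have -> : comp_le a b && unimodal a (Sset g) = [forall i : 'I_(size a), A i && B i].
  rewrite (comp_leE n) // (unimodalE n) //; last first.
    by apply/negP => /(Sset_bounds n g hg); rewrite ltnn andbF.
  apply/andP/forallP => [[/forallP HA /forallP HB] i|H]; last first.
    by split; apply/forallP => i; case/andP: (H i).
  by apply/andP; split; [apply: HA | apply: HB].
rewrite /blockprod; case: forallP => [H|/forallP]; last first.
  rewrite negb_forall => /existsP[i nAB]; rewrite (bigD1 i) //=.
  by rewrite /weight -/(psum _ _) !add0n; move: nAB; rewrite /A /B => /negbTE ->; rewrite mul0r mulr0.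
have ab : comp_le a b.
  by rewrite (comp_leE n) //; apply/forallP => i; case/andP: (H i).
pose w i : nat := psum a i.+1 - prevS (mem (Sset b)) (psum a i.+1).
have w0 (i : 'I_(size a)) : ((w i)%:R : rat) != 0%R.
  rewrite pnatr_eq0 -lt0n subn_gt0; apply: prevS_lt.
  exact: leq_ltn_trans (psum_lt n a ha i _).
transitivity (n`!%:R * \prod_(i < size a)
   ((-1 : rat) ^+ count (mem (Sset g)) (interior (psum a i) (psum a i.+1)) / (w i)%:R))%R
   ; last first.
  congr (_ * _)%R; apply: eq_bigr => i _.
  by rewrite /weight -!/(psum _ _) !add0n; have := H i; rewrite /A /B => ->.
(* Writing [n!] as [#|CONS n a b|] times the product of the window lengths cancels all
   denominators. *)
rewrite prodf_div -(card_CONS a) // natrM natr_prod.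
rewrite intrM rmorphXn rmorphN1 -mulrA; congr (_ * _)%R.
rewrite mulrC divfK; last by apply/prodf_neq0 => i _; apply: w0.
rewrite (count_notin_Sset n) ?(Sset_uniq n) //; last exact: Sset_bounds.
by elim/big_rec2: _ => // i x y _ <-; rewrite exprD.
Qed.

Lemma nobadE :
  nobad (mem (Sset b)) (mem (Sset g)) n = (comp_le b g)%:R%R.
Proof.
rewrite /nobad /comp_le; congr (nat_of_bool _)%:R%R; rewrite -all_predC.
apply/allP/allP => H x.
  move=> xg; have /andP[_ xn] := Sset_bounds n g hg x xg.
  by have := H x; rewrite mem_iota /= xn xg negbK => /(_ isT).
by move=> _ /=; rewrite negb_and negbK -implybE; apply/implyP => /H.
Qed.
End MainTerm.

Theorem theorem2p4 (n : nat) (b g : seq nat) :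
  is_comp n b -> is_comp n g ->
  (\sum_(a <- comps n | comp_le a b && unimodal a (Sset g))
     (Posz #|CONS n a b| * (-1 : int) ^+ (count (fun x => x \notin Sset a) (Sset g))))%R
  = (if comp_le b g then Posz (n`!) else Posz 0).
Proof.
(* The weights are fractions, so the integer identity is proved in [rat], where the integers embed
   injectively. *)
move=> hb hg; apply: (@intr_inj rat); rewrite big_mkcond rmorph_sum /=.
rewrite (eq_big_seq (fun a =>
  n`!%:R * blockprod rat (weight (mem (Sset b)) (mem (Sset g))) 0 a)%R); last first.
  by move=> a; rewrite mem_comps => ha; apply: term_blockprod.
rewrite -mulr_sumr (sum_blockprod _ _ _ (nobad (mem (Sset b)) (mem (Sset g)))) //.
  by rewrite (nobadE n) //; case: comp_le; rewrite ?mulr1 ?mulr0.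
move=> p /andP[p0 _]; apply: nobad_rec => //=.
by apply/negP => /(Sset_bounds n g hg).
Qed.
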